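(* Let $d$ and $p\ge d+1$ be positive integers, $\nu\in(0,1)$ and $\varepsilon_0>0$. Then for every integer $n\ge 1$ and all $x\in[0,\varepsilon_0n^{1/d}]$, $$\sup_{K\in\mathcal{P}(p,\nu,\varepsilon_0)}\mathbb{P}_K\left[n^{1/d}\,\mathsf{d}_{\mathsf H}(K,\hat K_n)\ge x\right]\le p\,e^{-\nu\kappa_dx^d},$$ where, under $\mathbb{P}_K$, $\hat K_n$ is the convex hull of $n$ i.i.d. points $X_1,\dots,X_n$ uniformly distributed in $K$.
   Context: $\kappa_d$ is the $d$-dimensional volume of the Euclidean unit ball in $\mathbb{R}^d$; $B_d(v,\varepsilon)$ is the closed Euclidean ball with center $v$ and radius $\varepsilon$; $\mathsf{Vol}_d$ is $d$-dimensional volume; $\mathsf{d}_{\mathsf H}$ is the Hausdorff distance. $\mathcal{P}(p,\nu,\varepsilon_0)$ is the class of all polytopes $K\subseteq[0,1]^d$ that have no more than $p$ vertices and such that $\mathsf{Vol}_d(B_d(v,\varepsilon)\cap K)\ge\nu\varepsilon^d\kappa_d$ for every vertex $v$ of $K$ and every $\varepsilon\in(0,\varepsilon_0)$. *)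

(* Defs.v *)
From HB Require Import structures.
From mathcomp Require Import all_boot all_order all_algebra.
From mathcomp Require Import all_classical all_reals all_analysis.

Set Implicit Arguments.
Unset Strict Implicit.
Unset Printing Implicit Defensive.

Import Order.TTheory GRing.Theory Num.Theory.
Import numFieldNormedType.Exports.

Local Open Scope classical_set_scope.
Local Open Scope ring_scope.

Definition rV_display : measure_display.
Proof. exact: default_measure_display. Qed.

(* 'rV[R]_d carries the product of the Borel sigma-algebras of R, i.e. the
   Borel sigma-algebra of R^d. *)
Section rV_measurable.
Context (R : realType) (d : nat).

Definition rV_coord (i : 'I_d) (v : 'rV[R]_d) : measurableTypeR R := v ord0 i.

Let rV_measurable0 : g_sigma_preimage rV_coord set0.
Proof. exact: sigma_algebra0. Qed.

Let rV_measurableC A :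
  g_sigma_preimage rV_coord A -> g_sigma_preimage rV_coord (~` A).
Proof. exact: sigma_algebraC. Qed.

Let rV_measurable_bigcup (F : (set 'rV[R]_d)^nat) :
  (forall i, g_sigma_preimage rV_coord (F i)) ->
  g_sigma_preimage rV_coord (\bigcup_i (F i)).
Proof. exact: sigma_algebra_bigcup. Qed.

HB.instance Definition _ := @isMeasurable.Build rV_display 'rV[R]_d
  (g_sigma_preimage rV_coord)
  rV_measurable0 rV_measurableC rV_measurable_bigcup.

End rV_measurable.

Section rV_measurable_fun.
Context (R : realType).

Lemma measurable_rV_coord d (i : 'I_d) :
  measurable_fun [set: 'rV[R]_d] (@rV_coord R d i).
Proof.
move=> _ Y mY; rewrite setTI; apply: sub_sigma_algebra => /=.
rewrite -bigcup_seq/=; exists i => /=; first by rewrite mem_index_enum.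
by exists Y => //; rewrite setTI.
Qed.

Lemma measurable_fun_rV disp (T : measurableType disp) d (f : T -> 'rV[R]_d) :
  (forall i, measurable_fun [set: T] (@rV_coord R d i \o f)) ->
  measurable_fun [set: T] f.
Proof.
move=> mf _ A mA.
have H : g_sigma_preimage (fun i => @rV_coord R d i \o f) `<=` measurable.
  apply: smallest_sub; first exact: sigma_algebra_measurable.
  rewrite -bigcup_seq/=; apply: bigcup_sub => i _ B [C mC <-]; exact: mf.
by apply: H; rewrite g_sigma_preimage_comp; exists A.
Qed.

Definition rV_cons d (xv : measurableTypeR R * 'rV[R]_d) : 'rV[R]_d.+1 :=
  \row_i (if unlift ord0 i is Some j then xv.2 ord0 j else xv.1).

Lemma rV_cons0 d xv : @rV_cons d xv ord0 ord0 = xv.1.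
Proof. by rewrite mxE unlift_none. Qed.

Lemma rV_consS d xv (j : 'I_d) :
  @rV_cons d xv ord0 (lift ord0 j) = xv.2 ord0 j.
Proof. by rewrite mxE liftK. Qed.

Lemma measurable_rV_cons d : measurable_fun setT (@rV_cons d).
Proof.
apply: measurable_fun_rV => i; case: (unliftP ord0 i) => [j ->|->].
  rewrite (_ : _ \o _ = @rV_coord R d j \o snd).
    apply: measurableT_comp => //; exact: measurable_rV_coord.
  by apply/funext => xv /=; rewrite /rV_coord rV_consS.
rewrite (_ : _ \o _ = fst)//.
by apply/funext => xv /=; rewrite /rV_coord rV_cons0.
Qed.

Definition rV_uncons d (w : 'rV[R]_d.+1) : measurableTypeR R * 'rV[R]_d :=
  (w ord0 ord0, \row_j w ord0 (lift ord0 j)).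

Lemma rV_consK d : cancel (@rV_cons d) (@rV_uncons d).
Proof.
move=> [x v]; congr (_, _); first exact: rV_cons0.
by apply/rowP => j; rewrite mxE rV_consS.
Qed.

Lemma rV_unconsK d : cancel (@rV_uncons d) (@rV_cons d).
Proof.
move=> w; apply/rowP => i; case: (unliftP ord0 i) => [j ->|->].
  by rewrite rV_consS mxE.
by rewrite rV_cons0.
Qed.

Lemma measurable_rV_uncons d : measurable_fun setT (@rV_uncons d).
Proof.
apply: measurable_fun_pair; first exact: (@measurable_rV_coord d.+1 ord0).
apply: measurable_fun_rV => i.
rewrite (_ : _ \o _ = @rV_coord R d.+1 (lift ord0 i)).
  exact: measurable_rV_coord.
by apply/funext => w; rewrite /rV_coord/= mxE.
Qed.

End rV_measurable_fun.

Section lebesgue_rV_step.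
Context (R : realType) (d : nat)
  (mu : {sigma_finite_measure set 'rV[R]_d -> \bar R}).

Definition lebesgue_rVS : set 'rV[R]_d.+1 -> \bar R :=
  pushforward (lebesgue_measure \x mu)%E (@rV_cons R d).

Let lebesgue_rVS0 : lebesgue_rVS set0 = 0%E.
Proof. by rewrite /lebesgue_rVS/pushforward preimage_set0 measure0. Qed.

Let lebesgue_rVS_ge0 A : (0 <= lebesgue_rVS A)%E.
Proof. by rewrite /lebesgue_rVS/pushforward measure_ge0. Qed.

Let lebesgue_rVS_sigma_additive : semi_sigma_additive lebesgue_rVS.
Proof.
rewrite /lebesgue_rVS; apply: measure_semi_sigma_additive.
exact: measurable_rV_cons.
Qed.

HB.instance Definition _ := isMeasure.Build _ _ _ lebesgue_rVS
  lebesgue_rVS0 lebesgue_rVS_ge0 lebesgue_rVS_sigma_additive.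

Let lebesgue_rVS_sigma_finite : sigma_finite setT lebesgue_rVS.
Proof.
have /sigma_finiteP[F [TF ndF Foo]] := sigma_finiteT (@lebesgue_measure R).
have /sigma_finiteP[G [TG ndG Goo]] := sigma_finiteT mu.
exists (fun k => @rV_uncons R d @^-1` (F k `*` G k)).
  rewrite -preimage_bigcup -[LHS](preimage_setT (@rV_uncons R d)).
  congr (_ @^-1` _); rewrite -setXTT TF TG; apply/seteqP; split=> -[x y].
    move=> [/= [i _ Fx] [j _ Gy]]; exists (maxn i j) => //; split.
    - by move: x Fx; exact/subsetPset/ndF/leq_maxl.
    - by move: y Gy; exact/subsetPset/ndG/leq_maxr.
  by move=> [k _ []/= ? ?]; split; exists k.
move=> k; have [mF Fk] := Foo k; have [mG Gk] := Goo k; split.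
  rewrite -[X in measurable X]setTI; apply: measurable_rV_uncons => //.
  exact: measurableX.
rewrite /lebesgue_rVS /pushforward -comp_preimage.
rewrite (_ : _ \o _ = id); last by apply/funext => xv; exact: rV_consK.
by rewrite preimage_id product_measure1E// lte_mul_pinfty// ge0_fin_numE.
Qed.

HB.instance Definition _ := Measure_isSigmaFinite.Build _ _ _ lebesgue_rVS
  lebesgue_rVS_sigma_finite.

End lebesgue_rV_step.

(* d-dimensional volume: the iterated product of the Lebesgue measure on R. *)
Fixpoint vol (R : realType) (d : nat) :
    {sigma_finite_measure set 'rV[R]_d -> \bar R} :=
  if d is d'.+1 then lebesgue_rVS (vol R d')
  else @dirac _ 'rV[R]_0 0 R.

Lemma vol_box (R : realType) (d : nat) (A : 'I_d -> set R) :
  (forall i, @measurable _ (measurableTypeR R) (A i)) ->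
  vol R d [set v | forall i, A i (v ord0 i)] =
    (\prod_(i < d) lebesgue_measure (A i))%E.
Proof.
elim: d A => [|d IH] A mA.
  by rewrite big_ord0 /= diracE mem_set// => -[].
pose B : set 'rV[R]_d := [set v | forall i, A (lift ord0 i) (v ord0 i)].
have mB : measurable B.
  rewrite (_ : B =
    \bigcap_(i in [set: 'I_d]) (@rV_coord R d i @^-1` A (lift ord0 i))).
    apply: fin_bigcap_measurable => // i _.
    by rewrite -[X in measurable X]setTI; exact: measurable_rV_coord.
  by apply/seteqP; split=> v /= Bv i => [_|]; exact: Bv.
rewrite big_ord_recl -(IH (fun i => A (lift ord0 i)))// -/B.
rewrite -product_measure1E//= /lebesgue_rVS /pushforward.
congr (product_measure1 _ _ _); apply/seteqP; split=> -[x v] /=.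
  move=> H; split => [|i]; first by have := H ord0; rewrite rV_cons0.
  by have := H (lift ord0 i); rewrite rV_consS.
move=> [Ax Av] i; case: (unliftP ord0 i) => [j ->|->].
  by rewrite rV_consS.
by rewrite rV_cons0.
Qed.

Section geometry.
Context (R : realType) (d : nat).
Implicit Types (v x y : 'rV[R]_d) (A B K : set 'rV[R]_d).

Definition enorm v : R := Num.sqrt (\sum_(i < d) v ord0 i ^+ 2).

(* The norm `|_| of 'rV[R]_d is the sup norm, hence enorm. *)
Definition eball v (r : R) : set 'rV[R]_d := [set x | enorm (x - v) <= r].

Definition kappa : R := fine (vol R d (eball 0 1)).

Definition hull A : set 'rV[R]_d := smallest (@convex_set R 'rV[R]_d) A.

(* Meaningful for nonempty bounded sets, where the set of radii is nonempty
   (inf is 0 on the empty set). *)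
Definition hausdorff A B : R :=
  inf [set r | [/\ 0 <= r,
    (forall x, A x -> exists2 y, B y & enorm (x - y) <= r) &
    (forall y, B y -> exists2 x, A x & enorm (x - y) <= r)]].

Definition polytope K := exists V : set 'rV[R]_d,
  [/\ finite_set V, V !=set0 & K = hull V].

(* The vertices of a polytope are its extreme points, i.e. its 0-faces. *)
Definition vertices K : set 'rV[R]_d := [set v | K v /\
  forall x y (t : R), K x -> K y -> 0 < t < 1 ->
    v = t *: x + (1 - t) *: y -> x = v /\ y = v].

Definition unit_cube : set 'rV[R]_d :=
  [set v | forall i, 0 <= v ord0 i <= 1].

Definition polytope_class (p : nat) (nu eps0 : R) : set (set 'rV[R]_d) :=
  [set K | [/\ polytope K, K `<=` unit_cube, (vertices K #<= `I_p)%card &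
    forall v, vertices K v -> forall eps, 0 < eps < eps0 ->
      ((nu * eps ^+ d * kappa)%:E <= vol R d (eball v eps `&` K))%E]].

(* Only used when 0 < vol K < +oo; x / 0 = 0 otherwise. *)
Definition uniform_on K (Q : set 'rV[R]_d -> \bar R) :=
  forall A, measurable A ->
    Q A = (fine (vol R d (A `&` K)) / fine (vol R d K))%:E.

End geometry.

(* Mutual independence of finitely many random variables; the product rule for
   subfamilies is the case A i = setT outside the subfamily. *)
Definition mutually_independent (R : realType) disp disp'
    (T : measurableType disp) (T' : measurableType disp')
    (P : probability T R) (n : nat) (X : 'I_n -> {mfun T >-> T'}) :=
  forall A : 'I_n -> set T', (forall i, measurable (A i)) ->
    P (\bigcap_(i in [set: 'I_n]) (X i @^-1` A i)) =
      (\prod_(i < n) P (X i @^-1` A i))%E.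

Definition iid_uniform (R : realType) disp (T : measurableType disp)
    (P : probability T R) (d n : nat) (X : 'I_n -> {mfun T >-> 'rV[R]_d})
    (K : set 'rV[R]_d) :=
  mutually_independent P X /\ forall i, uniform_on K (distribution P (X i)).

Definition sample_hull (R : realType) disp (T : measurableType disp)
    (d n : nat) (X : 'I_n -> {mfun T >-> 'rV[R]_d}) (w : T) : set 'rV[R]_d :=
  hull [set X i w | i in [set: 'I_n]].

(* Main.v *)
Require Import Defs.
From mathcomp Require Import all_boot all_order all_algebra.
From mathcomp Require Import all_classical all_reals all_analysis.
From mathcomp Require Import ring lra.

Set Implicit Arguments.
Unset Strict Implicit.
Unset Printing Implicit Defensive.

Import Order.TTheory GRing.Theory Num.Theory.
Import numFieldNormedType.Exports.

Local Open Scope classical_set_scope.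
Local Open Scope ring_scope.

(** Why the bound holds.  A polytope [K] is the hull of its vertices
    ([polytope_sub_hull_vertices]), and the points at distance at most [r] from
    the sample hull form a convex set.  Hence, as soon as each vertex of [K] has
    a sample point within distance [r], all of [K] lies within [r] of the sample
    hull; the sample hull lies in [K], so the Hausdorff distance is at most [r]
    ([hausdorff_vertices]).  A large distance therefore forces some vertex [v] to
    have no sample point in its ball of radius [r].  Since [K] lies in the unit
    cube, [vol K <= 1], so one sample point misses that ball with probability at
    most [1 - nu * kappa * r ^ d <= exp (- nu * kappa * r ^ d)]; independence
    raises this to the power [n], and the union bound over at most [p] vertices
    gives the factor [p] ([hausdorff_tail_lt], [hausdorff_tail]).  With
    [r = x / n ^ (1 / d)] the exponent [n * r ^ d] is [x ^ d].

    Two measurability facts support this.  Polytopes are Borel because they are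
    compact ([compact_hull_seq]), so that [vol K <= 1] by monotonicity and the
    complement of [K] is null for the uniform law.  The event itself is measurable because the Hausdorff distance
    from [K] to the hull of a sample is a Lipschitz function of the sample
    ([hausdorff_hull_lip]) and open conditions on finitely many measurable real
    functions are measurable ([measurable_open_condition]).

    Both the compactness of the hull of a finite set and Minkowski's theorem are
    obtained from the description of the hull of [v |` A] as the cone with apex
    [v] over the hull of [A] ([hull_setU1]). *)

(** * The Euclidean norm *)

Section enorm_theory.
Context (R : realType) (d : nat).
Implicit Types (u v w : 'rV[R]_d) (a : R).

Lemma enorm_ge0 v : 0 <= enorm v.
Proof. exact: sqrtr_ge0. Qed.

Lemma sqr_enorm v : enorm v ^+ 2 = \sum_(i < d) v ord0 i ^+ 2.
Proof. by rewrite sqr_sqrtr// sumr_ge0// => i _; exact: sqr_ge0. Qed.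

Lemma enorm0 : enorm (0 : 'rV[R]_d) = 0.
Proof. by rewrite /enorm big1 ?sqrtr0// => i _; rewrite mxE expr0n. Qed.

Lemma enormZ a v : enorm (a *: v) = `|a| * enorm v.
Proof.
rewrite /enorm -sqrtr_sqr -sqrtrM ?sqr_ge0// mulr_sumr.
by congr Num.sqrt; apply: eq_bigr => i _; rewrite mxE exprMn.
Qed.

Lemma enormN v : enorm (- v) = enorm v.
Proof. by rewrite -scaleN1r enormZ normrN1 mul1r. Qed.

Lemma enormB v w : enorm (v - w) = enorm (w - v).
Proof. by rewrite -enormN opprB. Qed.

Lemma enorm_eq0 v : enorm v = 0 -> v = 0.
Proof.
move=> v0; apply/rowP => i; rewrite mxE; apply/eqP.
rewrite -sqrf_eq0; apply/eqP; move: i (erefl true).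
apply: (@psumr_eq0P _ _ predT) => [i _|]; first exact: sqr_ge0.
by rewrite -sqr_enorm v0 expr0n.
Qed.

(** The scalar inequality
    (x + y) ^ 2 <= (A + B) * (x ^ 2 / A + y ^ 2 / B), summed over the
    coordinates with A and B the two norms, gives the triangle inequality
    without a separate Cauchy-Schwarz step; a vector of norm zero vanishes and
    is treated apart. *)
Lemma ler_enormD v w : enorm (v + w) <= enorm v + enorm w.
Proof.
have [/enorm_eq0->|v0] := eqVneq (enorm v) 0.
  by rewrite enorm0 !add0r.
have [/enorm_eq0->|w0] := eqVneq (enorm w) 0.
  by rewrite enorm0 !addr0.
have A0 : 0 < enorm v by rewrite lt_neqAle eq_sym v0 enorm_ge0.
have B0 : 0 < enorm w by rewrite lt_neqAle eq_sym w0 enorm_ge0.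
rewrite -(@ler_pXn2r _ 2) ?nnegrE ?addr_ge0 ?enorm_ge0// sqr_enorm.
set A := enorm v in v0 A0 *; set B := enorm w in w0 B0 *.
have -> : (A + B) ^+ 2 = (A + B) * (A ^+ 2 / A + B ^+ 2 / B).
  by rewrite !expr2 !mulfK.
rewrite 2!sqr_enorm !mulr_suml -big_split mulr_sumr /=; apply: ler_sum => i _.
rewrite mxE -subr_ge0; set x := v _ _; set y := w _ _.
have -> : (A + B) * (x ^+ 2 / A + y ^+ 2 / B) - (x + y) ^+ 2 =
    (B * x - A * y) ^+ 2 / (A * B) by field; rewrite v0 w0.
by rewrite divr_ge0 ?sqr_ge0// mulr_ge0// ltW.
Qed.

Lemma ler_enorm_dist u v w : enorm (u - w) <= enorm (u - v) + enorm (v - w).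
Proof. by apply: le_trans (ler_enormD _ _); rewrite addrA subrK. Qed.

Lemma enorm_le_sum v : enorm v <= \sum_(i < d) `|v ord0 i|.
Proof.
have S0 (r : seq 'I_d) : 0 <= \sum_(i <- r) `|v ord0 i|.
  by rewrite sumr_ge0.
rewrite -(@ler_pXn2r _ 2) ?nnegrE ?enorm_ge0 ?S0// sqr_enorm.
rewrite [in leRHS]unlock [in leLHS]unlock; elim: (index_enum _) => [|i r IH] /=.
  by rewrite expr0n.
have := S0 r; rewrite unlock /= => Sr0.
rewrite sqrrD real_normK ?num_real// -addrA lerD2l (le_trans IH)// lerDr.
by rewrite mulrn_wge0// mulr_ge0.
Qed.

(** The crude constant [d], in place of its square root, is enough: the bound
    serves only to compare bounded and open sets for the two norms. *)
Lemma enorm_le_box v (e : R) :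
  (forall i, `|v ord0 i| <= e) -> enorm v <= d%:R * e.
Proof.
move=> ve; apply: le_trans (enorm_le_sum v) _.
rewrite (le_trans (ler_sum _ (fun i _ => ve i)))// big_const_ord iter_addr.
by rewrite addr0 mulr_natl.
Qed.

End enorm_theory.

(** * Convex hulls *)

Lemma set_seq_cons (T : eqType) (z : T) (s : seq T) :
  [set` z :: s] = z |` [set` s].
Proof.
by apply/seteqP; split=> y /=; rewrite inE => /predU1P.
Qed.

Section hull_theory.
Context (R : realType) (d : nat).
Implicit Types (u v w x y : 'rV[R]_d) (A B H K : set 'rV[R]_d) (t r : R).

Lemma convex_setP A : @convex_set R 'rV[R]_d A <->
  forall x y t, A x -> A y -> 0 <= t <= 1 -> A (t *: x + (1 - t) *: y).
Proof.
split=> [cA x y t Ax Ay t01|cA x y l].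
  by have /set_mem := cA x y (Itv01 (andP t01).1 (andP t01).2) (mem_set Ax) (mem_set Ay).
rewrite !inE => Ax Ay; apply: (cA x y l%:num Ax Ay).
by rewrite ge0 le1.
Qed.

Lemma convex_hull A : @convex_set R 'rV[R]_d (hull A).
Proof.
apply/convex_setP => x y t hx hy t01 C [cC AC].
by move/convex_setP: (cC); apply => //; [exact: hx|exact: hy].
Qed.

Lemma sub_hull A : A `<=` hull A. Proof. exact: sub_gen_smallest. Qed.

Lemma hull_sub A B : @convex_set R 'rV[R]_d B -> A `<=` B -> hull A `<=` B.
Proof. exact: smallest_sub. Qed.

Lemma hull_mono A B : A `<=` B -> hull A `<=` hull B.
Proof. exact: sub_smallest2r (@convex_hull B). Qed.

(** Moving the two ends of a segment by at most [r] moves its points by at most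
    [r]; this makes the closed neighbourhoods of convex sets convex, and is the
    only way in which distances to a hull are estimated below. *)
Lemma convex_thickening A r : @convex_set R 'rV[R]_d A ->
  @convex_set R 'rV[R]_d [set x | exists2 y, A y & enorm (x - y) <= r].
Proof.
move=> /convex_setP cA; apply/convex_setP => x y t [x' Ax' xx'] [y' Ay' yy'].
move=> /andP[t0 t1]; exists (t *: x' + (1 - t) *: y'); first by apply: cA; rewrite ?t0.
rewrite (_ : _ - _ = t *: (x - x') + (1 - t) *: (y - y')); last first.
  by rewrite !scalerBr opprD addrACA.
have t1' : 0 <= 1 - t by rewrite subr_ge0.
rewrite (le_trans (ler_enormD _ _))// !enormZ !ger0_norm//.
by rewrite (_ : r = t * r + (1 - t) * r) ?lerD ?ler_wpM2l//; ring.
Qed.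

Lemma hull_thickening A B r :
  (forall x, A x -> exists2 y, hull B y & enorm (x - y) <= r) ->
  forall x, hull A x -> exists2 y, hull B y & enorm (x - y) <= r.
Proof. by apply: hull_sub; apply: convex_thickening; exact: convex_hull. Qed.

Lemma hull_set1 v : hull [set v] = [set v].
Proof.
apply/smallest_id/convex_setP => x y t -> -> _.
by rewrite -scalerDl addrC subrK scale1r.
Qed.

Lemma hull_bounded A v r :
  (forall x, A x -> enorm (x - v) <= r) ->
  forall x, hull A x -> enorm (x - v) <= r.
Proof.
move=> Ar x /(@hull_thickening _ [set v] r)[y /Ar yr|y].
  by exists v => //; exact: sub_hull.
by rewrite hull_set1 => ->.
Qed.

(** A combination of two points of the cone over a convex set [H] with apex [v]
    is again in that cone, and its apex weight is the combination of the two
    apex weights. *)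
Lemma cone_conv H v x y (t a b : R) : @convex_set R 'rV[R]_d H -> H x -> H y ->
  0 <= t <= 1 -> 0 <= a <= 1 -> 0 <= b <= 1 ->
  exists2 w, H w &
    t *: (a *: v + (1 - a) *: x) + (1 - t) *: (b *: v + (1 - b) *: y) =
    (t * a + (1 - t) * b) *: v + (1 - (t * a + (1 - t) * b)) *: w.
Proof.
move=> /convex_setP cH Hx Hy /andP[t0 t1] /andP[a0 a1] /andP[b0 b1].
set T := t * a + (1 - t) * b.
have xw : 0 <= t * (1 - a) by rewrite mulr_ge0// subr_ge0.
have yw : 0 <= (1 - t) * (1 - b) by rewrite mulr_ge0// subr_ge0.
have TE : 1 - T = t * (1 - a) + (1 - t) * (1 - b) by rewrite /T; ring.
have expand : t *: (a *: v + (1 - a) *: x) + (1 - t) *: (b *: v + (1 - b) *: y)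
    = T *: v + ((t * (1 - a)) *: x + ((1 - t) * (1 - b)) *: y).
  by rewrite !scalerDr !scalerA addrACA -scalerDl.
rewrite {}expand.
have [T1|T1] := eqVneq (1 - T) 0.
  (* only the apex has weight, and any base point serves *)
  exists x => //; rewrite T1; move: T1; rewrite TE => /eqP.
  rewrite paddr_eq0// => /andP[/eqP-> /eqP->].
  by rewrite !scale0r addr0.
have T0 : 0 < 1 - T by rewrite lt_neqAle eq_sym T1 TE addr_ge0.
exists ((t * (1 - a) / (1 - T)) *: x + (1 - t * (1 - a) / (1 - T)) *: y).
  apply: cH => //; rewrite divr_ge0 ?(ltW T0)//= ler_pdivrMr// mul1r TE.
  by rewrite lerDl.
rewrite scalerDr !scalerA; congr (_ + (_ *: _ + _ *: _)).
  by rewrite [RHS]mulrC divfK.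
by rewrite [RHS]mulrBr mulr1 [(1 - T) * _]mulrC divfK// TE addrAC subrr add0r.
Qed.

(** Adding one point to a nonempty set cones its hull off from that point.  All
    that is needed about hulls of finite sets follows by adding their points one
    at a time. *)
Lemma hull_setU1 A v : A !=set0 -> hull (v |` A) =
  [set t.1 *: v + (1 - t.1) *: t.2 | t in `[0, 1]%classic `*` hull A].
Proof.
move=> [a0 Aa0]; have vA : hull (v |` A) v by apply: sub_hull; left.
have cvA := (convex_setP (hull (v |` A))).1 (@convex_hull _).
apply/seteqP; split=> [|_ [[t w] [/= + hw] <-]]; last first.
  rewrite in_itv/= => t01; apply: cvA => //; move: w hw.
  by apply: hull_mono => w; right.
apply: hull_sub => [|x [->|Ax]].
- apply/convex_setP => _ _ t [[a x] [/= + hx] <-] [[b y] [/= + hy] <-].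
  rewrite !in_itv/= => a01 b01 t01.
  have [w hw ->] := cone_conv v (@convex_hull A) hx hy t01 a01 b01.
  exists (t * a + (1 - t) * b, w) => //; split=> //=; rewrite in_itv/=.
  case/andP: t01 => t0 t1; case/andP: a01 => a0' a1; case/andP: b01 => b0 b1.
  have t1' : 0 <= 1 - t by rewrite subr_ge0.
  rewrite addr_ge0 ?mulr_ge0//= (le_trans (lerD (ler_wpM2l t0 a1) (ler_wpM2l t1' b1)))//.
  by rewrite !mulr1 addrC subrK.
- exists (1, a0); first by split => /=; [rewrite in_itv/= ler01 lexx|exact: sub_hull].
  by rewrite /= subrr scale0r scale1r addr0.
- exists (0, x); first by split => /=; [rewrite in_itv/= ler01 lexx|exact: sub_hull].
  by rewrite /= subr0 scale0r scale1r add0r.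
Qed.

Lemma compact_hull_seq (s : seq 'rV[R]_d) : compact (hull [set` s]).
Proof.
elim: s => [|v [_|u s IH]].
- rewrite set_nil (_ : hull set0 = set0); first exact: compact0.
  by apply: smallest_id => x y t; rewrite inE.
- by rewrite set_cons1 hull_set1; exact: compact_set1.
- rewrite set_seq_cons hull_setU1; last by exists u; rewrite /= mem_head.
  apply: continuous_compact; last first.
    by apply: compact_setX IH; exact: segment_compact.
  apply: continuous_subspaceT => -[t w].
  apply: cvgD; apply: cvgZ => //=; last exact: cvg_snd.
  + exact: cvg_fst.
  + exact: cvg_cst.
  + by apply: cvgB; [exact: cvg_cst|exact: cvg_fst].
Qed.

(** The crux of Minkowski's theorem: if [v] lies outside the hull of the other
    points, a segment of the cone over that hull passing through the apex [v]
    in its interior has apex weight 1 at both ends. *)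
Lemma vertex_setU1 A v : ~ hull A v -> vertices (hull (v |` A)) v.
Proof.
move=> nAv; split; first by apply: sub_hull; left.
have [->|/set0P A0] := eqVneq A set0.
  by rewrite setU0 hull_set1 => x y t -> ->.
rewrite hull_setU1// => _ _ t [[a x] [/= + hx] <-] [[b y] [/= + hy] <-].
rewrite !in_itv/= => a01 b01 /andP[t0 t1].
have t01 : 0 <= t <= 1 by rewrite !ltW.
have [w hw ->] := cone_conv v (@convex_hull A) hx hy t01 a01 b01.
set T := t * a + _ => vE.
have T1 : T = 1.
  apply/eqP/negP => /negP; rewrite eq_sym -subr_eq0 => T1; apply: nAv.
  suff -> : v = w by [].
  apply: (scalerI T1); rewrite [LHS]scalerBl scale1r {1}vE.
  by rewrite addrAC subrr add0r.
case/andP: a01 => a0 a1; case/andP: b01 => b0 b1.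
have : t * (1 - a) + (1 - t) * (1 - b) = 0 by move: T1; rewrite /T; lra.
move/eqP; rewrite paddr_eq0 ?mulr_ge0 ?subr_ge0 ?(ltW t0) ?(ltW t1)//.
rewrite !mulf_eq0 (gt_eqF t0) [_ - t == _]subr_eq0 (gt_eqF t1)/=.
move=> /andP[/eqP/subr0_eq<- /eqP/subr0_eq<-].
by rewrite subrr !scale0r !addr0 scale1r.
Qed.

End hull_theory.

Section minkowski.
Context (R : realType) (d : nat).
Implicit Types (v x y : 'rV[R]_d) (K : set 'rV[R]_d).

(** Minkowski's theorem for a finite list of points: a point in the hull of the
    others can be dropped without changing the hull, and when no point can be
    dropped all of them are vertices. *)
Lemma hull_seq_vertices (s : seq 'rV[R]_d) :
  hull [set` s] `<=` hull (vertices (hull [set` s])).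
Proof.
have [m] := ubnP (size s); elim: m => // m IH in s *; rewrite ltnS => sm.
have splitE v : v \in s -> [set` s] = v |` [set` [seq u <- s | u != v]].
  move=> vs; apply/seteqP; split=> u /=; rewrite mem_filter.
    by move=> us; have [->|uv] := eqVneq u v; [left|right].
  by move=> [->//|/andP[]].
have [[v [vs hv]]|nv] :=
    pselect (exists v, v \in s /\ hull [set` [seq u <- s | u != v]] v).
  have <- : hull [set` [seq u <- s | u != v]] = hull [set` s].
    apply/seteqP; split.
      by apply: hull_mono => u /=; rewrite mem_filter => /andP[].
    apply: hull_sub; first exact: convex_hull.
    by rewrite (splitE v vs) => u [->//|us]; exact: sub_hull.
  apply: IH; apply: leq_trans sm; rewrite size_filter -(count_predC (pred1 v) s).
  by rewrite -[X in (X < _)%N]add0n ltn_add2r -has_count has_pred1.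
apply: hull_mono => v vs; rewrite (splitE v vs); apply: vertex_setU1 => hv.
by apply: nv; exists v.
Qed.

Lemma polytope_sub_hull_vertices K : polytope K -> K `<=` hull (vertices K).
Proof.
by move=> [V [/finite_seqP[s ->] _ ->]]; exact: hull_seq_vertices.
Qed.

Lemma compact_polytope K : polytope K -> compact K.
Proof. by move=> [V [/finite_seqP[s ->] _ ->]]; exact: compact_hull_seq. Qed.

Lemma convex_polytope K : polytope K -> @convex_set R 'rV[R]_d K.
Proof. by move=> [V [_ _ ->]]; exact: convex_hull. Qed.

Lemma polytope_neq0 K : polytope K -> K !=set0.
Proof. by move=> [V [_ [v Vv] ->]]; exists v; exact: sub_hull. Qed.

End minkowski.

(** * Measurability *)

Section measurability.
Context (R : realType).

(** Open conditions on finitely many real measurable functions define measurable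
    sets: an open set is the union of the countably many boxes with rational
    center and radius [1 / k] that it contains. *)
Lemma measurable_open_condition (J : finType) disp (T : measurableType disp)
    (Y : J -> T -> R) (U : set (J -> R)) :
  (forall j, measurable_fun [set: T] (Y j : T -> measurableTypeR R)) ->
  (forall u, U u -> exists2 e, 0 < e &
     forall u', (forall j, `|u j - u' j| < e) -> U u') ->
  measurable [set w | U (Y^~ w)].
Proof.
move=> mY oU.
pose box (qk : {ffun J -> rat} * nat) : set (J -> R) :=
  [set u | forall j, `|ratr (qk.1 j) - u j| < qk.2.+1%:R^-1].
pose F qk : set T :=
  if `[< box qk `<=` U >] then [set w | box qk (Y^~ w)] else set0.
(* a box not contained in U contributes nothing *)
rewrite (_ : [set w | _] = \bigcup_qk F qk).
  apply: countable_bigcupT_measurable; first exact: countableP.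
  move=> qk; rewrite /F; case: ifP => // _.
  rewrite (_ : [set w | _] = \bigcap_(j in [set: J])
      (Y j @^-1` [set` `](ratr (qk.1 j) - qk.2.+1%:R^-1),
                          (ratr (qk.1 j) + qk.2.+1%:R^-1)[])).
    apply: fin_bigcap_measurable => // j _; rewrite -[X in measurable X]setTI.
    by apply: mY => //; exact: measurable_itv.
  by apply/seteqP; split=> w /= bw j => [_|]; have := bw j;
    rewrite /= in_itv/= distrC ltr_distl => // /(_ I).
apply/seteqP; split=> [w /= /oU[e e0 eU]|w [qk _]]; last first.
  by rewrite /F; case: ifP => // /asboolP; exact.
(* the center of the box is only known up to its radius 1 / k.+1, hence e / 2 *)
have [k ke] : exists k : nat, k.+1%:R^-1 < e / 2.
  have := near_infty_natSinv_lt (PosNum (divr_gt0 e0 (ltr0n _ 2))).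
  by move=> [k _ /(_ k (leqnn k))]; exists k.
have q j : {q : rat | `|ratr q - Y j w| < k.+1%:R^-1}.
  apply: cid; have [|q] := @rat_in_itvoo R (Y j w - k.+1%:R^-1) (Y j w + k.+1%:R^-1).
    by rewrite ltrD2l gt0_cp// invr_gt0.
  by rewrite in_itv/= => qY; exists q; rewrite ltr_distl.
exists ([ffun j => sval (q j)], k) => //; rewrite /F; case: asboolP => [_ j|].
  by rewrite /= ffunE; exact: (svalP (q j)).
case=> u ux; apply: eU => j; have := ux j; rewrite /= ffunE.
have := svalP (q j); rewrite distrC => yq qu.
rewrite (le_lt_trans (ler_distD (ratr (sval (q j))) _ _))// [e]splitr.
by rewrite ltrD// (lt_trans _ ke).
Qed.

Context (d : nat).

Lemma measurable_rV_open (U : set 'rV[R]_d) : open U -> measurable U.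
Proof.
move=> oU.
rewrite (_ : U = [set v : 'rV[R]_d | U (\row_j (@rV_coord R d j v))]); last first.
  by apply/seteqP; split=> v /=;
     rewrite (_ : \row_j _ = v)//; apply/rowP => j; rewrite mxE.
apply: (@measurable_open_condition 'I_d rV_display 'rV[R]_d (@rV_coord R d)
  [set u | U (\row_j u j)]).
  by move=> j; exact: measurable_rV_coord.
move=> u Uu; have /nbhs_ballP[e e0 eU] := open_nbhs_nbhs (conj oU Uu).
exists e => // u' uu'; apply: eU; split=> // i j; rewrite !mxE.
exact: uu'.
Qed.

Lemma measurable_polytope (K : set 'rV[R]_d) : polytope K -> measurable K.
Proof.
move=> /compact_polytope/(compact_closed (@norm_hausdorff _ _)) cK.
rewrite -(setCK K); apply: measurableC; apply: measurable_rV_open.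
exact: closed_openC.
Qed.

Lemma measurable_eball (v : 'rV[R]_d) r : measurable (eball v r).
Proof.
rewrite -(setCK (eball v r)); apply: measurableC; apply: measurable_rV_open.
rewrite openE => x /= /negP; rewrite -ltNge => rx.
(* d.+1 and not d, so that the estimate is strict and d = 0 is covered *)
pose e := (enorm (x - v) - r) / d.+1%:R.
have e0 : 0 < e by rewrite divr_gt0// subr_gt0.
apply/nbhs_ballP; exists e => //= y [_ xy]; apply/negP; rewrite -ltNge.
have xyd : enorm (x - y) <= d%:R * e.
  apply: enorm_le_box => i; rewrite !mxE ltW//; exact: xy.
have de : d%:R * e < enorm (x - v) - r.
  by rewrite mulrCA gtr_pMr ?subr_gt0// ltr_pdivrMr// mul1r ltr_nat.
have := ler_enorm_dist x y v; lra.
Qed.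

Lemma measurable_unit_cube : measurable (@unit_cube R d).
Proof.
rewrite (_ : @unit_cube R d = \bigcap_(i in [set: 'I_d])
    (@rV_coord R d i @^-1` [set` `[0, 1]])).
  apply: fin_bigcap_measurable => // i _; rewrite -[X in measurable X]setTI.
  by apply: measurable_rV_coord => //; exact: measurable_itv.
apply/seteqP; split=> v vi i; first by move=> _; rewrite /= in_itv/=; exact: vi.
by have := vi i I; rewrite /= in_itv.
Qed.

Lemma vol_unit_cube : vol R d (@unit_cube R d) = 1%E.
Proof.
rewrite (_ : @unit_cube R d = [set v | forall i, `[0, 1]%classic (v ord0 i)]); last first.
  by apply/seteqP; split=> v /= vi i; have := vi i; rewrite in_itv.
rewrite (@vol_box R d (fun=> `[0, 1]%classic)) => [|i]; last exact: measurable_itv.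
by rewrite big1// => i _; rewrite lebesgue_measure_itv/= lte01 sube0.
Qed.

End measurability.

(** * The Hausdorff distance to a sample hull *)

Section hausdorff_theory.
Context (R : realType) (d : nat).
Implicit Types (v x y : 'rV[R]_d) (A B K : set 'rV[R]_d) (r : R).

Definition hausdorff_radii A B : set R := [set r | [/\ 0 <= r,
    (forall x, A x -> exists2 y, B y & enorm (x - y) <= r) &
    (forall y, B y -> exists2 x, A x & enorm (x - y) <= r)]].

Lemma hausdorff_le A B r : hausdorff_radii A B r -> hausdorff A B <= r.
Proof. by move=> ABr; apply: ge_inf => //; exists 0 => ? []. Qed.

Lemma hausdorff_ge0 A B : 0 <= hausdorff A B.
Proof.
rewrite /hausdorff -/(hausdorff_radii A B).
have [->|/set0P AB] := eqVneq (hausdorff_radii A B) set0; first by rewrite inf0.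
by apply: lb_le_inf => // r [].
Qed.

Lemma hausdorff_radii_neq0 A B r : A !=set0 -> B !=set0 ->
  (forall x, A x -> enorm x <= r) -> (forall y, B y -> enorm y <= r) ->
  hausdorff_radii A B !=set0.
Proof.
move=> [a Aa] [b Bb] Ar Br; exists (r + r).
have AB x y : A x -> B y -> enorm (x - y) <= r + r.
  move=> /Ar xr /Br yr; rewrite (le_trans (ler_enormD _ _))// enormN.
  exact: lerD.
split=> [|x Ax|y By]; last by exists a => //; exact: AB.
- by rewrite addr_ge0// (le_trans (enorm_ge0 a)) ?Ar.
- by exists b => //; exact: AB.
Qed.

Variables (K : set 'rV[R]_d) (n : nat).
Implicit Types z : 'I_n -> 'rV[R]_d.

Definition hull_of z : set 'rV[R]_d := hull [set z i | i in [set: 'I_n]].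

(** Moving every point of a sample by at most [e] moves its hull by at most [e];
    this is what makes the distance a measurable function of the sample. *)
Lemma hausdorff_hull_lip z z' (e : R) : (0 < n)%N ->
  polytope K -> K `<=` @unit_cube R d -> (forall i, enorm (z i - z' i) <= e) ->
  hausdorff K (hull_of z') <= hausdorff K (hull_of z) + e.
Proof.
move=> n0 pK Kcube zz'.
have e0 : 0 <= e by exact: le_trans (enorm_ge0 _) (zz' (Ordinal n0)).
have near (u u' : 'I_n -> 'rV[R]_d) : (forall i, enorm (u i - u' i) <= e) ->
    forall x, hull_of u x -> exists2 y, hull_of u' y & enorm (x - y) <= e.
  move=> uu'; apply: hull_thickening => _ [i _ <-]; exists (u' i) => //.
  by apply: sub_hull; exists i.
have ne : hausdorff_radii K (hull_of z) !=set0.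
  pose M := \sum_(i < n) enorm (z i) + d%:R.
  apply: (@hausdorff_radii_neq0 _ _ M).
  - exact: polytope_neq0.
  - by exists (z (Ordinal n0)); apply: sub_hull; exists (Ordinal n0).
  - move=> x /Kcube xc; rewrite -[enorm x]add0r lerD//.
      by rewrite sumr_ge0// => i _; exact: enorm_ge0.
    rewrite -[leRHS]mulr1; apply: enorm_le_box => i.
    by have /andP[x0 x1] := xc i; rewrite ger0_norm.
  - move=> y hy; rewrite -[y]subr0; move: y hy; apply: hull_bounded.
    move=> _ [i _ <-]; rewrite subr0 /M (bigD1 i)//= -addrA lerDl.
    by rewrite addr_ge0// sumr_ge0// => j _; exact: enorm_ge0.
rewrite -lerBlDr; apply: lb_le_inf => // r [r0 Kz zK]; rewrite lerBlDr.
apply: hausdorff_le; split=> [|x /Kz[y zy xy]|y hy]; first exact: addr_ge0.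
- have [y' zy' yy'] := near _ _ zz' _ zy; exists y' => //.
  by rewrite (le_trans (ler_enorm_dist _ y _))// lerD.
- have z'z i : enorm (z' i - z i) <= e by rewrite enormB.
  have [y' /zK[x Kx xy'] yy'] := near _ _ z'z _ hy; exists x => //.
  by rewrite (le_trans (ler_enorm_dist _ y' _))// lerD// enormB.
Qed.

(** A sample of [K] with a point within [r] of each vertex has a hull within [r]
    of [K]: the points within [r] of that hull form a convex set, and [K] is the
    hull of its vertices. *)
Lemma hausdorff_vertices z r : 0 <= r -> polytope K -> (forall i, K (z i)) ->
  (forall v, vertices K v -> exists i, eball v r (z i)) ->
  hausdorff K (hull_of z) <= r.
Proof.
move=> r0 pK Kz vz; apply: hausdorff_le; split=> // [x /polytope_sub_hull_vertices|y].
  move=> /(_ pK) hx; apply: hull_thickening hx => v /vz[i zi].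
  by exists (z i); [apply: sub_hull; exists i|rewrite enormB].
move=> /(hull_sub (convex_polytope pK)) Ky; exists y; last by rewrite subrr enorm0.
by apply: Ky => _ [i _ <-].
Qed.

Lemma measurable_hausdorff_hull disp (T : measurableType disp)
    (X : 'I_n -> {mfun T >-> 'rV[R]_d}) (c : R) :
  (0 < n)%N -> polytope K -> K `<=` @unit_cube R d ->
  measurable [set w | hausdorff K (hull_of (fun i => X i w)) < c].
Proof.
move=> n0 pK Kcube.
pose Y (ij : 'I_n * 'I_d) (w : T) : R := X ij.1 w ord0 ij.2.
pose z (u : 'I_n * 'I_d -> R) : 'I_n -> 'rV[R]_d := fun i => \row_j u (i, j).
rewrite (_ : [set w | _] =
    [set w | [set u | hausdorff K (hull_of (z u)) < c] (Y^~ w)]); last first.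
  apply/seteqP; split=> w /=;
    rewrite (_ : z _ = fun i => X i w)//; apply/funext => i;
    by apply/rowP => j; rewrite mxE.
apply: measurable_open_condition => [[i j]|u /= uc].
  rewrite (_ : Y _ = @rV_coord R d j \o X i)//.
  by apply: measurableT_comp => //; exact: measurable_rV_coord.
set h := hausdorff _ _ in uc.
exists ((c - h) / d.+1%:R) => [|u' uu']; first by rewrite divr_gt0// subr_gt0.
apply: le_lt_trans (hausdorff_hull_lip (z := z u)
    (e := d%:R * ((c - h) / d.+1%:R)) n0 pK Kcube _) _.
  by move=> i; apply: enorm_le_box => j; rewrite !mxE ltW.
rewrite -ltrBrDl -/h mulrCA gtr_pMr ?subr_gt0// ltr_pdivrMr// mul1r.
by rewrite ltr_nat.
Qed.

End hausdorff_theory.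

(** * Tail bound for one polytope *)

Section tail_bound.
Context (R : realType) (d : nat).
Implicit Types (K : set 'rV[R]_d) (v : 'rV[R]_d).

Lemma vol_polytope_le1 K : polytope K -> K `<=` @unit_cube R d ->
  (vol R d K <= 1)%E.
Proof.
move=> pK Kcube; rewrite -[leRHS](@vol_unit_cube R d) le_measure ?inE//.
  exact: measurable_polytope.
exact: measurable_unit_cube.
Qed.

Lemma prode_le_expn n (f : 'I_n -> \bar R) (q : R) :
  (forall i, 0 <= f i <= q%:E)%E -> (\prod_(i < n) f i <= (q ^+ n)%:E)%E.
Proof.
elim: n f => [|n IH] f f0q; first by rewrite big_ord0 expr0.
rewrite big_ord_recr/= exprSr EFinM lee_pmul//.
- by apply: prode_ge0 => i _; case/andP: (f0q (widen_ord (leqnSn n) i)).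
- by case/andP: (f0q ord_max).
- exact: IH.
- by case/andP: (f0q ord_max).
Qed.

Context (K : set 'rV[R]_d) (pK : polytope K) (Kcube : K `<=` @unit_cube R d).

Lemma uniform_vol_itv (Q : probability 'rV[R]_d R) : uniform_on K Q ->
  0 < fine (vol R d K) <= 1.
Proof.
move=> uQ; rewrite -[X in _ && X]lee_fin fineK ?vol_polytope_le1//; last first.
  by rewrite ge0_fin_numE// (le_lt_trans (vol_polytope_le1 pK Kcube))// ltry.
rewrite andbT lt_neqAle fine_ge0// andbT eq_sym; apply/eqP => V0.
have := uQ setT measurableT.
rewrite probability_setT setTI V0 mul0r => /eqP.
by rewrite -[1%E]/(1%:E) eqe oner_eq0.
Qed.

Lemma uniform_setC_null (Q : probability 'rV[R]_d R) : uniform_on K Q ->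
  Q (~` K) = 0%E.
Proof.
move=> uQ; rewrite uQ; last by apply: measurableC; exact: measurable_polytope.
by rewrite setICl measure0 mul0r.
Qed.

(** The normalization by [vol K <= 1] can only increase the mass of a set. *)
Lemma uniform_setC_le (Q : probability 'rV[R]_d R) (B : set 'rV[R]_d) (m : R) :
  uniform_on K Q -> measurable B -> (m%:E <= vol R d (B `&` K))%E ->
  (Q (~` B) <= (expR (- m))%:E)%E.
Proof.
move=> uQ mB mBK; have /andP[V0 V1] := uniform_vol_itv uQ.
have mK := measurable_polytope pK.
have BK1 : (vol R d (B `&` K) <= 1)%E.
  by apply: le_trans (vol_polytope_le1 pK Kcube);
    rewrite le_measure ?inE//; exact: measurableI.
have mle : m <= fine (vol R d (B `&` K)).
  rewrite -lee_fin fineK// ge0_fin_numE// (le_lt_trans BK1)// ltry//.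
rewrite probability_setC// (uQ _ mB) -EFinB lee_fin.
apply: le_trans (expR_ge1Dx (- m)); rewrite lerD2l lerN2 (le_trans mle)//.
by rewrite ler_pdivlMr// ler_piMr// fine_ge0.
Qed.

(** If the hull is farther than [r] from [K], then some sample point is outside
    [K] (a null event) or some vertex has no sample point within [r]; the latter
    is estimated by a union bound over the vertices and by independence. *)
Lemma hausdorff_tail_lt disp (T : measurableType disp) (P : probability T R)
    (n p : nat) (X : 'I_n -> {mfun T >-> 'rV[R]_d}) (c r m : R) :
  (0 < n)%N -> (vertices K #<= `I_p)%card -> iid_uniform P X K ->
  0 <= r < c ->
  (forall v, vertices K v -> m%:E <= vol R d (eball v r `&` K))%E ->
  (P [set w | (c <= hausdorff K (sample_hull X w))%R]
    <= (p%:R * expR (- m) ^+ n)%:E)%E.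
Proof.
move=> n0 cardV [indep unif] /andP[r0 rc] mball.
have finV : finite_set (vertices K).
  by apply: card_le_finite cardV _; exact: finite_II.
have mK := measurable_polytope pK.
have mX i (A : set 'rV[R]_d) : measurable A -> measurable (X i @^-1` A).
  by move=> mA; rewrite -[X in measurable X]setTI; exact: measurable_funPT.
pose s : seq 'rV[R]_d := finmap.enum_fset (fset_set (vertices K)).
have sE v : (v \in s) = (v \in vertices K) by rewrite -in_fset_set.
have sp : (size s <= p)%N by exact: geq_card_fset_set.
pose miss k : set T :=
  \bigcap_(i in [set: 'I_n]) (X i @^-1` (~` eball (nth 0 s k) r)).
pose out k : set T :=
  if insub k is Some i then X i @^-1` (~` K) else set0.
have mmiss k : measurable (miss k).
  apply: fin_bigcap_measurable => // i _; apply: mX; apply: measurableC.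
  exact: measurable_eball.
have mout k : measurable (out k).
  by rewrite /out; case: insubP => // i _ _; apply: mX; exact: measurableC.
have mB1 k : measurable (\big[setU/set0]_(i < k) miss i).
  by apply: bigsetU_measurable.
have mB2 k : measurable (\big[setU/set0]_(i < k) out i).
  by apply: bigsetU_measurable.
have mE : measurable [set w | c <= hausdorff K (sample_hull X w)].
  rewrite (_ : [set w | _] =
      ~` [set w | hausdorff K (hull_of (fun i => X i w)) < c]).
    by apply: measurableC; exact: measurable_hausdorff_hull.
  by apply/seteqP; split=> w /=; rewrite -/(hull_of _) leNgt => /negP.
have sub : [set w | c <= hausdorff K (sample_hull X w)] `<=`
    \big[setU/set0]_(k < size s) miss k `|` \big[setU/set0]_(k < n) out k.
  move=> w /= cw; rewrite -!bigcup_mkord; apply: contrapT => /not_orP[nmiss nout].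
  suff : hausdorff K (sample_hull X w) <= r by rewrite leNgt (lt_le_trans rc cw).
  apply: hausdorff_vertices => // [i|v Vv].
    apply: contrapT => nKi; apply: nout; exists i => /=; first exact: ltn_ord.
    rewrite /out insubT ?ltn_ord//= => iin.
    by rewrite (_ : Sub _ _ = i)//; exact: val_inj.
  apply: contrapT => nv; apply: nmiss; exists (index v s) => /=.
    by rewrite index_mem sE inE.
  move=> i _ /=; rewrite nth_index ?sE ?inE// => vi.
  by apply: nv; exists i.
apply: le_trans (le_measure P _ _ sub) _; rewrite ?inE//.
  exact: measurableU.
apply: le_trans (measureU2 P (mB1 _) (mB2 _)) _.
rewrite [X in (_ + X)%E](_ : _ = 0%E); last first.
  apply/eqP; rewrite -measure_le0; apply: le_trans (Boole_inequality P _) _ => //.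
  rewrite big1// => k _; rewrite /out; case: insubP => // i _ _.
  exact: (uniform_setC_null (unif i)).
rewrite adde0; apply: le_trans (Boole_inequality P _) _ => //.
apply: (@le_trans _ _ (\sum_(k < size s) (expR (- m) ^+ n)%:E)%E).
  apply: lee_sum => k _.
  rewrite [leLHS](indep (fun=> ~` eball (nth 0 s k) r)); last first.
    by move=> i; apply: measurableC; exact: measurable_eball.
  apply: prode_le_expn => i; rewrite measure_ge0/=.
  apply: (uniform_setC_le (unif i)); first exact: measurable_eball.
  by apply: mball; rewrite -[vertices K _]inE -sE mem_nth.
rewrite sumEFin lee_fin big_const_ord iter_addr addr0 -[leLHS]mulr_natl.
by rewrite ler_wpM2r ?ler_nat// exprn_ge0// expR_ge0.
Qed.

End tail_bound.

(** The density hypothesis holds only for radii below [eps0], and the event is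
    that the distance is at least [c], possibly with [c = eps0]: radii [t * c]
    with [t < 1] avoid both boundary cases, and [t] tends to 1 at the end. *)
Lemma hausdorff_tail (R : realType) (d p n : nat) (nu eps0 c : R)
    disp (T : measurableType disp) (P : probability T R)
    (X : 'I_n -> {mfun T >-> 'rV[R]_d}) (K : set 'rV[R]_d) :
  (0 < n)%N -> polytope_class p nu eps0 K -> iid_uniform P X K ->
  0 < c <= eps0 ->
  (P [set w | (c <= hausdorff K (sample_hull X w))%R]
    <= (p%:R * expR (- (nu * kappa R d * (n%:R * c ^+ d))))%:E)%E.
Proof.
move=> n0 [pK Kcube cardV ballV] iidX /andP[c0 ceps].
set E := [set w | _].
have tail t : 0 < t < 1 ->
    (P E <= (p%:R * expR (- (nu * kappa R d * (n%:R * (t * c) ^+ d))))%:E)%E.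
  move=> /andP[t0 t1]; have tc : t * c < c by rewrite gtr_pMl.
  have tc0 : 0 < t * c by exact: mulr_gt0.
  apply: le_trans (hausdorff_tail_lt pK Kcube (r := t * c)
    (m := nu * (t * c) ^+ d * kappa R d) n0 cardV iidX _ _) _.
  - by rewrite tc ltW.
  - by move=> v Vv; apply: ballV => //; rewrite tc0 (lt_le_trans tc).
  - by rewrite lee_fin -expRM_natl mulrN; rewrite le_eqVlt; apply/orP; left;
    apply/eqP; congr (_ * expR (- _)); ring.
pose f t := p%:R * expR (- (nu * kappa R d * (n%:R * (t * c) ^+ d))).
have PE : P E \is a fin_num.
  have := tail (1 / 2); rewrite ge0_fin_numE// => /(_ _)/le_lt_trans; apply.
    by rewrite ?ltry//; lra.
  exact: ltry.
have fc : {for 1, continuous f}.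
  apply: cvgMl_tmp; apply: continuous_comp; last exact: continuous_expR.
  apply: cvgN; do 2!apply: cvgMl_tmp.
  have := @exprn_continuous R d (1 * c); move=> /(continuous_cvg _); apply.
  by apply: cvgMr_tmp; exact: cvg_id.
have -> : p%:R * expR (- (nu * kappa R d * (n%:R * c ^+ d))) = f 1.
  by rewrite /f mul1r.
have fc1 : f t @[t --> 1^'-] --> f 1 by exact: cvg_at_left_filter.
rewrite -(fineK PE) lee_fin; apply: (cvgr_to_ge fc1).
near=> t; rewrite -lee_fin fineK//; apply: tail; apply/andP; split; near: t.
  exact: nbhs_left_gt.
exact: nbhs_left_lt.
Unshelve. all: by end_near. Qed.

Theorem theorem6 (R : realType) (d p : nat) (nu eps0 : R)
  (d_gt0 : (0 < d)%N) (p_ge : (d.+1 <= p)%N)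
  (nu_itv : 0 < nu < 1) (eps0_gt0 : 0 < eps0)
  (n : nat) (n_gt0 : (1 <= n)%N)
  (disp : measure_display) (Omega : measurableType disp)
  (X : 'I_n -> {mfun Omega >-> 'rV[R]_d})
  (P : set 'rV[R]_d -> probability Omega R)
  (X_iid : forall K, polytope_class p nu eps0 K -> iid_uniform (P K) X K)
  (x : R) (x_itv : 0 <= x <= eps0 * n%:R `^ (d%:R^-1)) :
  (ereal_sup
     [set P K [set w | (x <= n%:R `^ (d%:R^-1) * hausdorff K (sample_hull X w))%R]
       | K in polytope_class p nu eps0]
   <= (p%:R * expR (- (nu * kappa R d * x ^+ d)))%:E)%E.
Proof.
apply: ge_ereal_sup => _ [K classK <-].
have n0 : 0 < n%:R :> R by rewrite ltr0n.
set a := n%:R `^ _ in x_itv *; have a0 : 0 < a by exact: powR_gt0.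
have aX : a ^+ d = n%:R.
  by rewrite -powR_mulrn ?(ltW a0)// -powRrM mulVf ?powRr1// ?(ltW n0)// pnatr_eq0 -lt0n.
(* at x = 0 the distance gives no information, but the bound is p >= 1 *)
case/andP: x_itv; rewrite [0 <= x]le_eqVlt => /predU1P[<- _|x0 xa].
  have -> : expR (- (nu * kappa R d * 0 ^+ d)) = 1.
    by rewrite expr0n gtn_eqF//= mulr0 oppr0 expR0.
  have [pK Kcube _ _] := classK.
  apply: le_trans (probability_le1 _ _) _; last first.
    by rewrite mulr1 lee_fin ler1n (leq_trans _ p_ge).
  rewrite [X in measurable X](_ : _ = setT)//.
  apply/seteqP; split=> // w _ /=; rewrite mulr_ge0 ?(ltW a0)//.
  exact: hausdorff_ge0.
rewrite (_ : [set w | _] = [set w | x / a <= hausdorff K (sample_hull X w)]); last first.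
  by apply/seteqP; split=> w /=; rewrite ler_pdivrMr// mulrC.
have -> : x ^+ d = n%:R * (x / a) ^+ d.
  by rewrite -aX -exprMn mulrC divfK// gt_eqF.
apply: (hausdorff_tail n_gt0 classK (X_iid K classK)).
by rewrite divr_gt0//= ler_pdivrMr.
Qed.
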